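(* Blink (as defined in the context) satisfies Agreement: in every execution, no two correct servers decide different values, i.e. if two correct servers trigger $\langle con.\mathrm{Decide}\mid v\rangle$ and $\langle con.\mathrm{Decide}\mid w\rangle$ respectively, then $v=w$.
   Context: **Model.** $f\ge 0$ is an integer; $\Pi$ is a fixed, commonly known set of $n=5f+1$ servers, of which at most $f$ are faulty (Byzantine: may behave arbitrarily and collude); the others are correct and follow the algorithm. Any two servers (including a server and itself) communicate via reliable, authenticated, FIFO links, with message delays bounded by an unknown constant $\Delta$. Event handlers execute atomically. $\mathbb B=\{\mathtt{True},\mathtt{False}\}$. **Binary Consensus** (instance $dep$): every correct server proposes one value via $\langle dep.\mathrm{Propose}\mid p\rangle$, $p\in\mathbb B$, and may trigger $\langle dep.\mathrm{Decide}\mid d\rangle$, $d\in\mathbb B$. Integrity: no correct server decides more than once. Agreement: no two correct servers decide different values. Termination: if every correct server proposes, every correct server eventually decides. Validity: a decided value was proposed by at least one correct server. **Blink** (instance $con$, built on one Binary Consensus instance $dep$). Every correct server triggers $\langle con.\mathrm{Propose}\mid\cdot\rangle$ exactly once. Each server keeps a map $suggestions$ from $\Pi$ to $\mathbb B$ (initially empty) and flags $proposed=decided=\mathtt{False}$. (i) Upon $\langle con.\mathrm{Propose}\mid v\rangle$: send $[\mathtt{Suggest},v]$ to every server. (ii) Upon delivering $[\mathtt{Suggest},v]$ from $\sigma\in\Pi$: set $suggestions[\sigma]=v$. (iii) Upon $|suggestions|\ge 4f+1$ (number of keys) and $proposed=\mathtt{False}$: pick $v$ with $|\{\pi: suggestions[\pi]=v\}|\ge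 2f+1$, trigger $\langle dep.\mathrm{Propose}\mid v\rangle$, set $proposed=\mathtt{True}$. (iv) Upon existence of $v$ with $|\{\pi: suggestions[\pi]=v\}|\ge 4f+1$: if $decided=\mathtt{False}$, trigger $\langle con.\mathrm{Decide}\mid v\rangle$ and set $decided=\mathtt{True}$. (v) Upon $\langle dep.\mathrm{Decide}\mid v\rangle$: if $decided=\mathtt{False}$, trigger $\langle con.\mathrm{Decide}\mid v\rangle$ and set $decided=\mathtt{True}$. *)

(* Defs.v *)
From HB Require Import structures.
From mathcomp Require Import all_boot all_order all_algebra.
From mathcomp Require Import reals.

Set Implicit Arguments.
Unset Strict Implicit.
Unset Printing Implicit Defensive.

Import Order.TTheory GRing.Theory Num.Theory.

(** * Consensus properties

    [propose i p v] (resp. [decide i p v]) means that the [i]-th event of the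
    execution triggers Propose v (resp. Decide v) at server [p]. *)

Section Consensus.
Variables (server : finType) (correct : {set server}).
Variables (propose decide : nat -> server -> bool -> Prop).

Definition integrity : Prop :=
  forall p i j v w, p \in correct ->
    decide i p v -> decide j p w -> i = j /\ v = w.

Definition agreement : Prop :=
  forall p q i j v w, p \in correct -> q \in correct ->
    decide i p v -> decide j q w -> v = w.

Definition termination : Prop :=
  (forall p, p \in correct -> exists i v, propose i p v) ->
  forall p, p \in correct -> exists i v, decide i p v.

Definition validity : Prop :=
  forall p i v, p \in correct -> decide i p v ->
    exists q j, q \in correct /\ propose j q v.

Record binary_consensus : Prop := BinaryConsensus {
  bc_integrity : integrity;
  bc_agreement : agreement;
  bc_termination : termination;
  bc_validity : validity }.
End Consensus.

(** * Blink: the code of one correct server *)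

Inductive message := Suggest of bool.

(** The map [suggestions] is a function to [option bool]; its keys are the
    servers not sent to [None]. *)
Record local_state (server : finType) := LocalState {
  suggestions : {ffun server -> option bool};
  proposed : bool;
  decided : bool }.

(** Triggers of the five handlers. [SuggestionsReached] and [QuorumReached]
    stand for the two handlers guarded by a condition on [suggestions]. *)
Inductive input (server : finType) :=
  | ConPropose of bool
  | Deliver of server & message
  | SuggestionsReached
  | QuorumReached
  | DepDecide of bool.
Arguments ConPropose {server} _.
Arguments SuggestionsReached {server}.
Arguments QuorumReached {server}.
Arguments DepDecide {server} _.

Inductive output (server : finType) :=
  | Send of server & message
  | DepPropose of bool
  | ConDecide of bool.
Arguments DepPropose {server} _.
Arguments ConDecide {server} _.

Section Algorithm.
Variables (f : nat) (server : finType).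
Implicit Types (s : local_state server) (p q : server) (v : bool).

Definition initial_local_state : local_state server :=
  LocalState [ffun=> None] false false.

Definition suggestion_count s : nat := #|[set p | suggestions s p != None]|.

Definition value_count s v : nat := #|[set p | suggestions s p == Some v]|.

Definition set_suggestion s q v : local_state server :=
  LocalState [ffun p => if p == q then Some v else suggestions s p]
    (proposed s) (decided s).

Definition set_proposed s : local_state server :=
  LocalState (suggestions s) true (decided s).

Definition set_decided s : local_state server :=
  LocalState (suggestions s) (proposed s) true.

Definition decide_once s v : seq (output server) :=
  if decided s then [::] else [:: ConDecide v].

Definition propose_guard s : bool :=
  (4 * f + 1 <= suggestion_count s) && ~~ proposed s.

Definition quorum_guard s : bool :=
  [exists v : bool, 4 * f + 1 <= value_count s v].

(** [handler s a s' outs]: in state [s], the handler of [a] can run (atomically)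
    with final state [s'], triggering [outs]. *)
Inductive handler s :
  input server -> local_state server -> seq (output server) -> Prop :=
  | handle_con_propose v :
      handler s (ConPropose v) s [seq Send q (Suggest v) | q <- enum server]
  | handle_suggest q v :
      handler s (Deliver q (Suggest v)) (set_suggestion s q v) [::]
  | handle_suggestions_reached v :
      propose_guard s -> 2 * f + 1 <= value_count s v ->
      handler s SuggestionsReached (set_proposed s) [:: DepPropose v]
  | handle_quorum_reached v :
      4 * f + 1 <= value_count s v ->
      handler s QuorumReached (set_decided s) (decide_once s v)
  | handle_dep_decide v :
      handler s (DepDecide v) (set_decided s) (decide_once s v).
End Algorithm.

(** * Executions *)

Section Outputs.
Variable server : finType.
Implicit Types outs : seq (output server).

Definition sent_to (q : server) outs : seq message :=
  pmap (fun o => if o is Send r m then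
                   if r == q then Some m else None
                 else None) outs.

Definition dep_proposed outs : seq bool :=
  pmap (fun o => if o is DepPropose v then Some v else None) outs.

Definition con_decided outs : seq bool :=
  pmap (fun o => if o is ConDecide v then Some v else None) outs.
End Outputs.

(** [Act p a outs]: server [p] acts on trigger [a] and outputs [outs]. A correct
    server always has a trigger; a faulty one may also act spontaneously
    ([a = None]). [Idle] lets an execution with finitely many events be
    represented as an infinite sequence. *)
Inductive event (server : finType) :=
  | Idle
  | Act of server & option (input server) & seq (output server).
Arguments Idle {server}.

(** [link c q p] is the FIFO queue (oldest first) of the messages in transit from
    [q] to [p], each paired with the time at which it was sent. *)
Record config (server : finType) (R : realType) := Config {
  local : server -> local_state server;
  link : server -> server -> seq (message * R) }.

(** The [i]-th event occurs at time [ev_time x i] and leads from configuration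
    [conf x i] to configuration [conf x i.+1]. *)
Record execution (server : finType) (R : realType) := Execution {
  ev : nat -> event server;
  conf : nat -> config server R;
  ev_time : nat -> R }.

Section Executions.
Variables (f : nat) (server : finType) (faulty : {set server}) (R : realType).
Implicit Types (c : config server R) (p q r : server).
Implicit Types (a : option (input server)) (x : execution server R).

(** Only the oldest message of a link can be delivered. *)
Definition deliverable c p a : Prop :=
  if a is Some (Deliver q m) then exists t l, link c q p = (m, t) :: l
  else True.

Definition link_after_delivery c p a q r : seq (message * R) :=
  if a is Some (Deliver q0 _) then
    if (q == q0) && (r == p) then behead (link c q r) else link c q r
  else link c q r.

(** No constraint bears on the outputs and on the local state of a faulty
    server; but it can only append to its own outgoing links (authentication),
    and it only consumes messages that are delivered to it. *)
Definition step (now : R) c (e : event server) (c' : config server R) : Prop :=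
  match e with
  | Idle =>
      (forall p, local c' p = local c p) /\
      (forall q r, link c' q r = link c q r)
  | Act p a outs =>
      [/\ p \notin faulty ->
            exists2 b, a = Some b &
              handler f (local c p) b (local c' p) outs,
          forall q, q != p -> local c' q = local c q,
          deliverable c p a &
          forall q r,
            link c' q r = link_after_delivery c p a q r ++
              (if q == p then [seq (m, now) | m <- sent_to r outs] else [::])]
  end.

Definition acts_on x (i : nat) p (b : input server) : Prop :=
  exists outs, ev x i = Act p (Some b) outs.

Definition con_proposes x (i : nat) p (v : bool) : Prop :=
  acts_on x i p (ConPropose v).

Definition con_decides x (i : nat) p (v : bool) : Prop :=
  exists a outs, ev x i = Act p a outs /\ v \in con_decided outs.

Definition dep_proposes x (i : nat) p (v : bool) : Prop :=
  exists a outs, ev x i = Act p a outs /\ v \in dep_proposed outs.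

Definition dep_decides x (i : nat) p (v : bool) : Prop :=
  acts_on x i p (DepDecide v).

(** In [be_delay], [t] is the sending time of a message still in transit when the
    [i]-th event occurs (possibly its delivery). As time is unbounded, every
    message sent at time [t] is hence delivered, no later than [t + Delta].
    [be_run_propose] and [be_run_quorum] say that a correct server does not
    ignore forever a handler whose guard remains true. *)
Record blink_execution (Delta : R) x : Prop := BlinkExecution {
  be_init_local : forall p, local (conf x 0) p = initial_local_state server;
  be_init_link : forall q p, link (conf x 0) q p = [::];
  be_step : forall i, step (ev_time x i) (conf x i) (ev x i) (conf x i.+1);
  be_time : forall i, (ev_time x i <= ev_time x i.+1)%R;
  be_time_unbounded : forall t : R, exists i, (t <= ev_time x i)%R;
  be_delay : forall i q p t, t \in unzip2 (link (conf x i) q p) ->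
    (ev_time x i <= t + Delta)%R;
  be_con_propose : forall p, p \notin faulty ->
    exists i v, con_proposes x i p v /\
      forall j w, con_proposes x j p w -> j = i;
  be_run_propose : forall p i, p \notin faulty ->
    exists j, i <= j /\
      (acts_on x j p SuggestionsReached \/
       ~~ propose_guard f (local (conf x j) p));
  be_run_quorum : forall p i, p \notin faulty ->
    exists j, i <= j /\
      (acts_on x j p QuorumReached \/
       ~~ quorum_guard f (local (conf x j) p)) }.
End Executions.

(* Main.v *)
(** Since a correct server proposes once and links are authenticated and start
    empty, all correct servers that hold a suggestion of a given correct server
    hold the same one. Hence if [v] and [w] have at least [k] and [l] suggestions
    at two correct servers (possibly at different times) and [k + l > 6f + 1], the
    two sets of suggesters share more than [f] servers, so a correct one, and
    [v = w]. A direct decision has [k = 4f + 1]; a decision taken from the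
    underlying consensus was, by its validity, proposed to it by a correct server,
    so [k = 2f + 1]. Both sums [8f + 2] and [6f + 2] suffice; two decisions of the
    second kind agree by the agreement of the underlying consensus. *)
Require Import Defs.
From HB Require Import structures.
From mathcomp Require Import all_boot all_order all_algebra.
From mathcomp Require Import reals zify.

Set Implicit Arguments.
Unset Strict Implicit.
Unset Printing Implicit Defensive.

Import Order.TTheory GRing.Theory Num.Theory.

(** If [A :&: B] were inside [C], inclusion-exclusion would bound [#|A| + #|B|] by [#|T| + #|C|]. *)
Lemma card_setI_exceeds (T : finType) (A B C : {set T}) :
  #|T| + #|C| < #|A| + #|B| -> exists2 x, x \in A :&: B & x \notin C.
Proof.
move=> lt_card; apply/subsetPn; apply: contraTN lt_card => /subset_leq_card leIC.
rewrite -leqNgt -cardsUI leq_add //; exact: max_card.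
Qed.

Section Suggestions.
Variables (f : nat) (server : finType) (faulty : {set server}) (R : realType).
Implicit Types (c : config server R) (p q r : server) (v w : bool).

Definition carries v (mt : message * R) : bool :=
  let: (Suggest w, _) := mt in w == v.

(** The invariant covers messages in transit as well as recorded suggestions: a recorded value is
    one that came off a link. *)
Definition only_suggests q v c : Prop :=
  (forall p, all (carries v) (link c q p)) /\
  (forall p w, p \notin faulty ->
     suggestions (local c p) q = Some w -> w = v).

Lemma sent_to_con_propose r v (s : seq server) (t : R) :
  all (carries v) [seq (m, t) | m <- sent_to r [seq Send q (Suggest v) | q <- s]].
Proof. by elim: s => //= q s IHs; case: eqP => //= _; rewrite eqxx. Qed.

Lemma sent_to_decide_once (s : local_state server) r v :
  sent_to r (decide_once s v) = [::].
Proof. by rewrite /decide_once; case: decided. Qed.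

(** Only the [ConPropose] handler sends messages; for any other trigger the list is empty and [v] is
    arbitrary. *)
Lemma handler_sends s b s' outs r v (t : R) :
    handler f s b s' outs -> (forall w, b = ConPropose w -> w = v) ->
  all (carries v) [seq (m, t) | m <- sent_to r outs].
Proof.
case=> // [w /(_ w erefl) -> | w _ _ | w _]; first exact: sent_to_con_propose.
  by rewrite sent_to_decide_once.
by rewrite sent_to_decide_once.
Qed.

Lemma handler_suggestions (s s' : local_state server) b outs q w :
    handler f s b s' outs -> suggestions s' q = Some w ->
  suggestions s q = Some w \/ b = Deliver q (Suggest w).
Proof.
case=> [v | r v | v _ _ | v _ | v] /=; try by left.
by rewrite ffunE; case: eqP => [-> [->] | _]; [right | left].
Qed.

Lemma all_link_after_delivery c p a q r P :
  all P (link c q r) -> all P (link_after_delivery c p a q r).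
Proof.
case: a => [[] |] //= q0 _; case: ifP => // _.
by case: (link c q r) => //= m l /andP[].
Qed.

(** Only [q] can append to its outgoing links, and a correct [q] does so only when it proposes;
    deliveries merely remove messages. *)
Lemma only_suggests_step (now : R) c e c' q v :
    q \notin faulty -> step f faulty now c e c' ->
    (forall w outs, e = Act q (Some (ConPropose w)) outs -> w = v) ->
  only_suggests q v c -> only_suggests q v c'.
Proof.
move=> correct_q + prop_v [linkv sugv]; case: e prop_v => [_ | p a outs prop_v] /=.
  by case=> loc lnk; split=> [p | p w]; rewrite ?loc ?lnk //; apply: sugv.
case=> run loc dlv lnk; split=> [r | r w correct_r].
  rewrite lnk all_cat all_link_after_delivery //=.
  case: eqP => // eq_qp; subst p; have [b def_a hb] := run correct_q.
  by apply: handler_sends hb _ => w def_b; apply: prop_v; rewrite def_a def_b.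
have [eq_rp | neq_rp] := eqVneq r p; last by rewrite loc //; apply: sugv.
subst r; have [b def_a hb] := run correct_r.
case/(handler_suggestions hb) => [|def_b]; first exact: sugv.
(* The recorded suggestion was the head of the link from [q], whose messages all carry [v]. *)
move: dlv (linkv p); rewrite def_a def_b /= => -[t [l ->]] /=.
by case/andP=> /eqP.
Qed.

Variables (Delta : R) (x : execution server R).
Hypothesis blink_x : blink_execution f faulty Delta x.

Lemma correct_only_suggests q : q \notin faulty ->
  exists v, forall i, only_suggests q v (conf x i).
Proof.
move=> correct_q; have [j [v [prop_v uniq_j]]] := be_con_propose blink_x correct_q.
exists v; elim=> [|i IHi].
  split=> [p | p w _]; first by rewrite (be_init_link blink_x).
  by rewrite (be_init_local blink_x) ffunE.
apply: only_suggests_step (be_step blink_x i) _ IHi => // w outs ev_i.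
(* A proposal by [q] at step [i] must be its unique one, at step [j], whose value is [v]. *)
have eq_ij : i = j by apply: (uniq_j i w); exists outs.
by case: prop_v => outs'; rewrite -eq_ij ev_i => -[].
Qed.

(** Server and time are existential, so that supports seen at different servers and times can be
    compared. *)
Definition supported k v : Prop :=
  exists2 p, p \notin faulty & exists i, k <= value_count (local (conf x i) p) v.

Lemma supported_eq k l v w : #|server| + #|faulty| < k + l ->
  supported k v -> supported l w -> v = w.
Proof.
move=> lt_kl [p cp [i le_k]] [q cq [j le_l]].
have [|r] := @card_setI_exceeds _
  [set r | suggestions (local (conf x i) p) r == Some v]
  [set r | suggestions (local (conf x j) q) r == Some w] faulty.
  exact: leq_trans lt_kl (leq_add le_k le_l).
rewrite !inE => /andP[/eqP sug_v /eqP sug_w] cr.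
have [u only_u] := correct_only_suggests cr.
by rewrite ((only_u i).2 p v cp sug_v) ((only_u j).2 q w cq sug_w).
Qed.

Lemma correct_event i p a outs : p \notin faulty -> ev x i = Act p a outs ->
  exists2 b, a = Some b &
    handler f (local (conf x i) p) b (local (conf x i.+1) p) outs.
Proof.
by move=> cp ev_i; have := be_step blink_x i; rewrite ev_i => -[/(_ cp)].
Qed.

Lemma con_decided_decide_once (s : local_state server) v w :
  w \in con_decided (decide_once s v) -> w = v.
Proof. by rewrite /decide_once; case: decided => //=; rewrite inE => /eqP. Qed.

(** Only two handlers output [ConDecide]; the guard of the first gives the support, in the state
    before the event. *)
Lemma con_decides_origin i p v : p \notin faulty -> con_decides x i p v ->
  supported (4 * f + 1) v \/ dep_decides x i p v.
Proof.
move=> cp [a [outs [ev_i dec_v]]].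
have [b def_a hb] := correct_event cp ev_i; subst a.
case: hb ev_i dec_v => [w | q w | w _ _ | w le_w | w] ev_i //=.
- by elim: (enum server).
- by move/con_decided_decide_once->; left; exists p => //; exists i.
- by move/con_decided_decide_once->; right; eexists; exact: ev_i.
Qed.

Lemma dep_proposes_supported i p v : p \notin faulty -> dep_proposes x i p v ->
  supported (2 * f + 1) v.
Proof.
move=> cp [a [outs [ev_i prop_v]]]; have [b _ hb] := correct_event cp ev_i.
case: hb prop_v => [w | q w | w _ le_w | w _ | w] //=.
- by elim: (enum server).
- by rewrite inE => /eqP->; exists p => //; exists i.
- by rewrite /decide_once; case: decided.
- by rewrite /decide_once; case: decided.
Qed.

End Suggestions.

Theorem theorem4 (f : nat) (server : finType) (faulty : {set server})
    (R : realType) (Delta : R) (x : execution server R)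
    (card_server : #|server| = 5 * f + 1)
    (card_faulty : #|faulty| <= f)
    (Delta_gt0 : (0 < Delta)%R)
    (blink_x : blink_execution f faulty Delta x)
    (dep_consensus :
       binary_consensus (~: faulty) (dep_proposes x) (dep_decides x)) :
  agreement (~: faulty) (con_decides x).
Proof.
have supp_dep i p v : p \in ~: faulty -> dep_decides x i p v ->
    supported faulty x (2 * f + 1) v.
  move=> cp /(bc_validity dep_consensus cp)[q [j []]]; rewrite inE.
  exact: (dep_proposes_supported blink_x).
move=> p q i j v w cp cq dec_v dec_w.
have [ncp ncq] : p \notin faulty /\ q \notin faulty by split; rewrite -in_setC.
have [sv | dv] := con_decides_origin blink_x ncp dec_v;
  have [sw | dw] := con_decides_origin blink_x ncq dec_w.
(* Servers and faulty servers total at most [6f + 1], which the mixed sums [6f + 2] below exceed by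
   as little as one. *)
- by apply: (supported_eq blink_x _ sv sw); lia.
- by apply: (supported_eq blink_x _ sv (supp_dep _ _ _ cq dw)); lia.
- by apply: (supported_eq blink_x _ (supp_dep _ _ _ cp dv) sw); lia.
- exact: bc_agreement dep_consensus _ _ _ _ _ _ cp cq dv dw.
Qed.
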